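(* Suppose $C$ is a constant such that $ C^2 \geq \frac14 \sup\limits_{1\leq k\leq n} \frac 1{\Re (q_{k}) \Re {\left(\frac 1{p_{k}}\right)}}$, where $p_k, q_k, z \in S_{\theta}$ with $0\leq \theta < \pi/2$ and $p_k, q_k \neq 0$. If $|z-C|\leq C$ then \begin{equation*} \left|\cfrac{1}{q_1+\cfrac{1}{p_1+\cfrac{1}{q_2+\cfrac{1}{p_2+\cdots+\cfrac{1}{q_n+\cfrac{1}{p_n+z}}}}}}-C\right| \leq C. \end{equation*}
   Context: For $0\leq\theta<\pi/2$, $S_{\theta}=\{z\in\mathbb{C}:|\mathrm{Arg}\,z|\leq\theta\}$ denotes the closed sector of half-angle $\theta$ about the positive real axis. The expression in the claim is the finite continued fraction with partial numerators all equal to $1$ and partial denominators $q_1,p_1,q_2,p_2,\dots,q_n,p_n+z$ in this order. *)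

(* Defs.v *)
From HB Require Import structures.
From mathcomp Require Import all_boot all_order all_algebra.
From mathcomp Require Import classical_sets reals trigo.
Import Order.TTheory GRing.Theory Num.Theory.
From mathcomp Require Import complex.

Set Implicit Arguments.
Unset Strict Implicit.
Unset Printing Implicit Defensive.

Local Open Scope classical_set_scope.
Local Open Scope ring_scope.
Local Open Scope complex_scope.

(* Principal argument, with values in ]-pi, pi] (see ArgP); the value at 0 is
   irrelevant. The norm `|z| lives in R[i], so Re `|z| is the real modulus. *)
Definition Arg (R : realType) (z : R[i]) : R :=
  let t := acos (Re z / Re `|z|) in if Im z < 0 then - t else t.

Lemma ArgP (R : realType) (z : R[i]) : z != 0 ->
  - pi < Arg z <= pi /\ z = `|z| * (cos (Arg z) +i* sin (Arg z)).
Proof.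
move=> z0; set r := Re `|z|.
have rE : `|z| = r%:C by rewrite /r normc_def.
have r_gt0 : 0 < r by rewrite -ltcR -rE normr_gt0.
have rr : r ^+ 2 = Re z ^+ 2 + Im z ^+ 2.
  by rewrite /r normc_def /= sqr_sqrtr // addr_ge0 ?sqr_ge0.
have rn0 : r != 0 by rewrite gt_eqF.
set c := Re z / r.
have cE : 1 - c ^+ 2 = (Im z / r) ^+ 2.
  by apply/eqP; rewrite subr_eq !expr_div_n -mulrDl addrC -rr divff ?expf_neq0.
have c2 : c ^+ 2 <= 1 by rewrite -subr_ge0 cE sqr_ge0.
have cB : -1 <= c <= 1.
  by rewrite -ler_norml -(@expr_le1 _ 2) // real_normK ?num_real.
have zE s : s = Im z / r -> z = r%:C * (c +i* s).
  move=> ->; apply/eqP; rewrite eq_complex /= !mul0r subr0 addr0 /c.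
  by rewrite ![r * _]mulrC !divfK // !eqxx.
have sE : sin (acos c) = `|Im z| / r.
  by rewrite sin_acos // cE sqrtr_sqr normrM normfV (gtr0_norm r_gt0).
rewrite rE /Arg -/r -/c /=; case: (ltP (Im z) 0) => Iz; last first.
  split; last by rewrite acosK ?in_itv //; apply: zE; rewrite sE ger0_norm.
  by rewrite acos_lepi // andbT (lt_le_trans _ (acos_ge0 cB)) // oppr_lt0 pi_gt0.
split; last first.
  rewrite cosN sinN acosK ?in_itv //; apply: zE.
  by rewrite sE ltr0_norm // mulNr opprK.
rewrite ltrN2 (le_trans _ (pi_ge0 R)) ?oppr_le0 ?acos_ge0 // andbT acos_ltpi //.
have /andP[cl ->] := cB; rewrite andbT lt_neqAle cl andbT.
apply/eqP => cN; move/eqP: cE; rewrite -cN sqrrN expr1n subrr eq_sym.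
by rewrite sqrf_eq0 mulf_eq0 invr_eq0 (negPf rn0) orbF lt_eqF.
Qed.

(* The closed sector contains its vertex 0, where the argument is undefined. *)
Definition sector (R : realType) (theta : R) : set R[i] :=
  [set z | z = 0 \/ `|Arg z| <= theta].

(* cfrac [:: b_1; ...; b_m] z is the continued fraction
   1/(b_1 + 1/(b_2 + ... + 1/(b_m + z))), i.e. the one with partial
   denominators b_1, ..., b_{m-1}, b_m + z. *)
Definition cfrac (F : fieldType) (b : seq F) (z : F) : F :=
  foldr (fun d x => 1 / (d + x)) z b.

(* [:: q_0; p_0; q_1; p_1; ...; q_{n-1}; p_{n-1}] *)
Definition interleave (T : Type) (n : nat) (q p : 'I_n -> T) : seq T :=
  flatten [seq [:: q k; p k] | k <- enum 'I_n].

(* Main.v *)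
Require Import Defs.
From mathcomp Require Import all_boot all_order all_algebra.
From mathcomp Require Import classical_sets reals trigo.
Import Order.TTheory GRing.Theory Num.Theory.
From mathcomp Require Import complex.
From mathcomp Require Import ring lra.

Local Open Scope classical_set_scope.
Local Open Scope ring_scope.
Local Open Scope complex_scope.

(* A nonzero [w] lies in the closed disk of centre and radius [r > 0] iff its
   inverse lies in the half-plane [Re >= 1 / (2 r)].  Disks tangent at [0] add
   up: [p] lies in the one of radius [1 / (2 Re (1/p))], so [p + w] lies in the
   one of radius [C + 1 / (2 Re (1/p))] whenever [w] lies in that of radius
   [C]; the hypothesis on [C] then gives
   [Re (q + 1 / (p + w)) >= 1 / (2 C)]. *)

(** Squaring cancels [r ^+ 2] on both sides. Unlike the half-plane form, this one also makes sense
    at [w = 0]. *)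
Lemma tangent_diskE (R : realType) (r : R) (w : R[i]) : 0 <= r ->
  (`|w - r%:C| <= r%:C) = (Re w ^+ 2 + Im w ^+ 2 <= 2 * r * Re w).
Proof.
move=> r0; rewrite normc_def lecR -[r in _ <= r]ger0_norm // -sqrtr_sqr.
case: w => x y; rewrite ler_sqrt ?sqr_ge0 //=.
by apply/idP/idP => ?; nra.
Qed.

Lemma ReD (R : realType) (v w : R[i]) : Re (v + w) = Re v + Re w.
Proof. by case: v w => [? ?] [? ?]. Qed.

Lemma Re_inv (R : realType) (w : R[i]) :
  Re w^-1 = Re w / (Re w ^+ 2 + Im w ^+ 2).
Proof. by case: w. Qed.

Lemma Re_gt0_sqnorm_gt0 (R : realType) (w : R[i]) :
  0 < Re w -> 0 < Re w ^+ 2 + Im w ^+ 2.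
Proof. by move=> w0; rewrite ltr_pwDl ?sqr_ge0 ?exprn_gt0. Qed.

Lemma Re_inv_gt0 (R : realType) (w : R[i]) : 0 < Re w -> 0 < Re w^-1.
Proof. by move=> w0; rewrite Re_inv divr_gt0 ?Re_gt0_sqnorm_gt0. Qed.

Lemma tangent_disk_Re_inv (R : realType) (r : R) (w : R[i]) :
  0 < r -> 0 < Re w ->
  (`|w - r%:C| <= r%:C) = ((2 * r)^-1 <= Re w^-1).
Proof.
move=> r0 w0; rewrite (tangent_diskE _ _ _ (ltW r0)) Re_inv.
by rewrite ler_pdivlMr ?Re_gt0_sqnorm_gt0 // ler_pdivrMl ?mulr_gt0.
Qed.

(** The disk touches the imaginary axis at [0] from the right. This keeps [p + w] off zero in the
    recursion step. *)
Lemma tangent_disk_Re_ge0 (R : realType) (r : R) (w : R[i]) :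
  0 < r -> `|w - r%:C| <= r%:C -> 0 <= Re w.
Proof.
move=> r0; rewrite (tangent_diskE _ _ _ (ltW r0)) => wr.
have : 0 <= 2 * r * Re w by apply: le_trans wr; rewrite addr_ge0 ?sqr_ge0.
by rewrite pmulr_rge0 ?mulr_gt0.
Qed.

Lemma tangent_diskD (R : realType) (r s : R) (v w : R[i]) :
  `|v - r%:C| <= r%:C -> `|w - s%:C| <= s%:C ->
  `|v + w - (r + s)%:C| <= (r + s)%:C.
Proof.
move=> vr ws; rewrite rmorphD /= opprD addrACA.
by rewrite (le_trans (ler_normD _ _)) // lerD.
Qed.

(** [Re w] is the modulus times [cos (Arg w)], and the argument stays strictly between [- pi / 2]
    and [pi / 2]. *)
Lemma sector_Re_gt0 (R : realType) (theta : R) (w : R[i]) :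
  theta < pi / 2 -> sector theta w -> w <> 0 -> 0 < Re w.
Proof.
move=> tpi [-> //|]; move=> wt /eqP w0.
have [_ ->] := ArgP w0.
have cos0 : 0 < cos (Arg w).
  apply: cos_gt0_pihalf; rewrite -ltr_norml; exact: le_lt_trans tpi.
have wE : `|w| = (Re `|w|)%:C by rewrite normc_def.
have r0 : 0 < Re `|w| by rewrite -ltcR -wE normr_gt0.
by rewrite wE /= mul0r subr0 mulr_gt0.
Qed.

(** Used with [a = Re q] and [s = Re p^-1]. The difference of the two inverse diameters is
    [1 / (2 C (1 + 2 C s))], so the claim is [1 <= 2 a C + 4 C^2 a s], whose last term is already at
    least [1]. *)
Lemma half_radius_inv_le (F : realFieldType) (C s a : F) :
  0 < C -> 0 < s -> 0 < a -> 1 / 4 * (1 / (a * s)) <= C ^+ 2 ->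
  (2 * C)^-1 <= a + (2 * ((2 * s)^-1 + C))^-1.
Proof.
move=> C0 s0 a0 hC.
have Cs0 : 0 < 1 + 2 * C * s by rewrite addr_gt0 ?mulr_gt0.
have rE : (2 * ((2 * s)^-1 + C))^-1 = s / (1 + 2 * C * s).
  by field; rewrite !gt_eqF // mulrC mulrA.
have dE : (2 * C)^-1 = s / (1 + 2 * C * s) + (2 * C * (1 + 2 * C * s))^-1.
  by field; rewrite !gt_eqF.
rewrite dE rE addrC lerD2r.
have hq : 1 <= 4 * C ^+ 2 * (a * s).
  by rewrite -ler_pdivrMr ?mulr_gt0 // -ler_pdivrMl // -div1r.
rewrite -div1r ler_pdivrMr ?mulr_gt0 //.
by rewrite (le_trans hq) //; have := mulr_gt0 a0 C0; nra.
Qed.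

Lemma tangent_disk_cfrac_step (R : realType) (C : R) (p q w : R[i]) :
  0 < C -> 0 < Re p -> 0 < Re q ->
  1 / 4 * (1 / (Re q * Re (1 / p))) <= C ^+ 2 ->
  `|w - C%:C| <= C%:C ->
  `|1 / (q + 1 / (p + w)) - C%:C| <= C%:C.
Proof.
move=> C0 p0 q0; rewrite [1 / p]div1r => hC wC; rewrite !div1r.
set s := Re p^-1 in hC; have s0 : 0 < s by exact: Re_inv_gt0.
have pw0 : 0 < Re (p + w).
  by rewrite ReD ltr_pwDl ?(tangent_disk_Re_ge0 _ _ _ C0).
(* With this radius [p] lies on the boundary circle: the half-plane inequality becomes [s <= s]. *)
have ps : `|p - ((2 * s)^-1)%:C| <= ((2 * s)^-1)%:C.
  rewrite tangent_disk_Re_inv ?invr_gt0 ?mulr_gt0 //.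
  by rewrite invfM invrK mulrA mulVf ?mul1r // pnatr_eq0.
have := tangent_diskD _ _ _ _ _ ps wC.
rewrite tangent_disk_Re_inv ?addr_gt0 ?invr_gt0 ?mulr_gt0 // => pwr.
have t0 : 0 < Re (q + (p + w)^-1) by rewrite ReD addr_gt0 ?Re_inv_gt0.
rewrite tangent_disk_Re_inv ?Re_inv_gt0 // invrK ReD.
by rewrite (le_trans (half_radius_inv_le _ _ _ _ C0 s0 q0 hC)) ?lerD2l.
Qed.

(** Stated for any list of indices, so that induction peels off the outermost pair and the tail
    plays the role of [w]. *)
Lemma tangent_disk_cfrac (R : realType) (C : R) (I : Type) (p q : I -> R[i])
    (z : R[i]) (s : seq I) :
  0 < C -> (forall k, 0 < Re (p k)) -> (forall k, 0 < Re (q k)) ->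
  (forall k, 1 / 4 * (1 / (Re (q k) * Re (1 / p k))) <= C ^+ 2) ->
  `|z - C%:C| <= C%:C ->
  `|cfrac (flatten [seq [:: q k; p k] | k <- s]) z - C%:C| <= C%:C.
Proof.
by move=> C0 p0 q0 hC zC; elim: s => //= k s; exact: tangent_disk_cfrac_step.
Qed.

Lemma le_sup_fin_image (R : realType) (I : finType) (f : I -> R) (i : I) :
  f i <= sup [set f k | k in [set: I]].
Proof.
apply: ub_le_sup; last by exists i.
(* The sum of absolute values serves as an upper bound, so that [sup] is a genuine supremum. *)
exists (\sum_k `|f k|) => _ [k _ <-].
by rewrite (le_trans (ler_norm _)) // (bigD1 k) //= lerDl sumr_ge0.
Qed.

Theorem theorem2p8 (R : realType) (theta : R) (n : nat)
    (p q : 'I_n -> R[i]) (z : R[i]) (C : R)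
    (htheta0 : 0 <= theta) (htheta : theta < pi / 2)
    (hn : (0 < n)%N)
    (hp : forall k, sector theta (p k)) (hq : forall k, sector theta (q k))
    (hz : sector theta z)
    (hp0 : forall k, p k <> 0) (hq0 : forall k, q k <> 0)
    (hC : C ^+ 2 >=
      1 / 4 * sup [set 1 / (Re (q k) * Re (1 / p k)) | k in [set: 'I_n]])
    (hzC : `|z - C%:C| <= C%:C) :
  `|cfrac (interleave q p) z - C%:C| <= C%:C.
Proof.
have p0 k : 0 < Re (p k) by exact: sector_Re_gt0 _ _ _ htheta (hp k) (hp0 k).
have q0 k : 0 < Re (q k) by exact: sector_Re_gt0 _ _ _ htheta (hq k) (hq0 k).
have hCk k : 1 / 4 * (1 / (Re (q k) * Re (1 / p k))) <= C ^+ 2.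
  apply: le_trans hC; rewrite ler_wpM2l ?divr_ge0 //.
  exact: (@le_sup_fin_image _ _ (fun k => 1 / (Re (q k) * Re (1 / p k)))).
have C_ge0 : 0 <= C by rewrite -lecR; exact: le_trans (normr_ge0 _) hzC.
(* The bound at index [0], available since [0 < n], puts a positive number below [C ^+ 2]. *)
have C_gt0 : 0 < C.
  rewrite lt_neqAle C_ge0 andbT eq_sym -sqrf_eq0 gt_eqF //.
  apply: lt_le_trans (hCk (Ordinal hn)).
  by rewrite !mulr_gt0 ?invr_gt0 ?mulr_gt0 // [1 / p _]div1r Re_inv_gt0.
exact: tangent_disk_cfrac.
Qed.
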